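(* Let $\mathcal{S}$ be a separable Banach lattice, $p\ge1$, and $\psi_p(z)=1+\|z\|^p$. Suppose a total preorder $\succeq$ on $\mathcal{P}^{\psi_p}(\mathcal{S})$ is continuous (in the $\psi_p$-weak topology), risk-averse, and satisfies the independence axiom. Then there exists a concave function $u\in C_b^{\psi_p}(\mathcal{S})$ such that $U(\mu)=\int_{\mathcal{S}}u(z)\,\mu(dz)$ is a numerical representation of $\succeq$ on $\mathcal{P}^{\psi_p}(\mathcal{S})$.
   Context: $C_b^{\psi}(\mathcal{S})=\{f : f/\psi \text{ bounded continuous}\}$; $\mathcal{M}^\psi(\mathcal{S})$ is the space of regular signed Borel measures $\mu$ with $|\int f\,d\mu|<\infty$ for all $f\in C_b^\psi$; $\mathcal{P}^\psi(\mathcal{S})$ its probability measures; $\psi$-weak convergence means convergence of $\int f\,d\mu_n$ for all $f\in C_b^\psi$. For $\mu\in\mathcal{P}^{\psi_p}(\mathcal{S})$ and a $\sigma$-subalgebra $\mathcal{G}$ of the Borel $\sigma$-algebra $\mathcal{B}$, the conditional expectation $\mathcal{E}_{\mu|\mathcal{G}}:\mathcal{S}\to\mathcal{S}$ is a $\mathcal{G}$-measurable map with $\int_G\mathcal{E}_{\mu|\mathcal{G}}(z)\,\mu(dz)=\int_G z\,\mu(dz)$ for all $G\in\mathcal{G}$ (Bochner integrals), and $\mu_{\mathcal{G}}(A)=\mu(\mathcal{E}_{\mu|\mathcal{G}}^{-1}(A))$, $A\in\mathcal{B}$. The preorder is risk-averse if $\mu_{\mathcal{G}}\succeq\mu$ for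 all $\mu\in\mathcal{P}^{\psi_p}(\mathcal{S})$ and all $\sigma$-subalgebras $\mathcal{G}$. Total preorder, continuity (closed upper and lower contour sets), numerical representation ($z\succ v\iff U(z)>U(v)$), and the independence axiom ($\mu\succ\nu\Rightarrow\alpha\mu+(1-\alpha)\lambda\succ\alpha\nu+(1-\alpha)\lambda$, $\alpha\in(0,1)$) are as usual. *)

(* Defs.v *)
From HB Require Import structures.
From mathcomp Require Import all_boot all_order all_algebra.
From mathcomp Require Import all_classical all_reals all_analysis.
Set Implicit Arguments. Unset Strict Implicit. Unset Printing Implicit Defensive.
Import Order.TTheory GRing.Theory Num.Theory.
Import numFieldNormedType.Exports.
Local Open Scope classical_set_scope.
Local Open Scope ring_scope.

Definition is_sup {S : Type} (le : S -> S -> Prop) (x y s : S) :=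
  le x s /\ le y s /\ (forall t, le x t -> le y t -> le s t).

Definition banach_lattice_order {R : realType} {S : completeNormedModType R}
    (le : S -> S -> Prop) : Prop :=
  (forall x, le x x) /\
      (forall x y z, le x y -> le y z -> le x z) /\
      (forall x y, le x y -> le y x -> x = y) /\
      (forall x y z, le x y -> le (x + z) (y + z)) /\
      (forall (a : R) x y, 0 <= a -> le x y -> le (a *: x) (a *: y)) /\
      (forall x y, exists s, is_sup le x y s) /\
      (forall x y ax ay, is_sup le x (- x) ax -> is_sup le y (- y) ay ->
          le ax ay -> `|x| <= `|y|).

Definition separable {T : topologicalType} :=
  exists f : nat -> T, closure (range f) = setT.

Definition Borel (T : ptopologicalType) := g_sigma_algebraType (@open T).

Definition psi_p {R : realType} {S : normedModType R} (p : R) (z : S) : R :=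
  1 + `|z| `^ p.

Definition Cbpsi {R : realType} {S : normedModType R} (psi : S -> R)
    (f : S -> R) : Prop :=
  continuous (fun z => f z / psi z) /\
  exists M : R, forall z, `|f z / psi z| <= M.

Definition Ppsi {R : realType} {S : completeNormedModType R} (psi : S -> R)
    (mu : probability (Borel S) R) : Prop :=
  forall f : S -> R, Cbpsi psi f ->
    mu.-integrable setT (fun x : Borel S => (f x)%:E).

(* closedness of a subset A of P^psi in the psi-weak topology (relative to
   P^psi): the complement is open for the initial topology of the maps
   mu |-> \int f dmu, f in C_b^psi. *)
Definition psi_weak_closed {R : realType} {S : completeNormedModType R}
    (psi : S -> R) (A : set (probability (Borel S) R)) : Prop :=
  forall mu, Ppsi psi mu -> ~ A mu ->
    exists (fs : seq (S -> R)) (e : R), 0 < e /\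
      (forall f, f \in fs -> Cbpsi psi f) /\
      (forall nu, Ppsi psi nu ->
         (forall f, f \in fs ->
            (`| \int[nu]_x (f x)%:E - \int[mu]_x (f x)%:E | < e%:E)%E) ->
         ~ A nu).

(* simple functions: finite lists of (measurable set, vector) *)
Definition sfun_eval {R : realType} {S : completeNormedModType R}
    (s : seq (set S * S)) (x : S) : S :=
  \sum_(q <- s) (\1_(q.1) x : R) *: q.2.

Definition sfun_int {R : realType} {S : completeNormedModType R}
    (mu : probability (Borel S) R) (D : set S) (s : seq (set S * S)) : S :=
  \sum_(q <- s) fine (mu (D `&` q.1)) *: q.2.

Definition bochner {R : realType} {S : completeNormedModType R}
    (mu : probability (Borel S) R) (D : set S) (f : S -> S) (v : S) : Prop :=
  measurable_fun (D : set (Borel S)) (f : Borel S -> Borel S) /\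
  exists s : nat -> seq (set S * S),
    (forall n q, q \in s n -> measurable (q.1 : set (Borel S))) /\
    (fun n => \int[mu]_(x in D) (`|f x - sfun_eval (s n) x| : R)%:E)%E
       @ \oo --> 0%E /\
    (fun n => sfun_int mu D (s n)) @ \oo --> v.

Definition sub_sigma {S : ptopologicalType} (G : set (set S)) : Prop :=
  sigma_algebra setT G /\ G `<=` (@measurable _ (Borel S)).

Definition cond_exp {R : realType} {S : completeNormedModType R}
    (mu : probability (Borel S) R) (G : set (set S)) (E : S -> S) : Prop :=
  (forall A, measurable (A : set (Borel S)) -> G (E @^-1` A)) /\
  (forall B, G B -> exists v, bochner mu B E v /\ bochner mu B id v).

Definition is_mixture {R : realType} {S : completeNormedModType R} (a : R)
    (mu lam nu : probability (Borel S) R) : Prop :=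
  forall A, measurable (A : set (Borel S)) ->
    nu A = (a%:E * mu A + (1 - a)%:E * lam A)%E.

Definition concave_fun {R : realType} {S : normedModType R} (u : S -> R) :=
  forall (x y : S) (t : R), 0 <= t <= 1 ->
    t * u x + (1 - t) * u y <= u (t *: x + (1 - t) *: y).

(* Main.v *)
Require Import Defs.
From HB Require Import structures.
From mathcomp Require Import all_boot all_order all_algebra ring lra.
From mathcomp Require Import all_classical all_reals all_analysis measurable_realfun.
Set Implicit Arguments. Unset Strict Implicit. Unset Printing Implicit Defensive.
Import Order.TTheory GRing.Theory Num.Theory.
Import numFieldNormedType.Exports.
Local Open Scope classical_set_scope.
Local Open Scope ring_scope.

(** Identify a measure with the linear functional it induces on C_b^psi.  The
    measures in P^psi then form a convex set of functions, and the preference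
    on it is a linear order: a preference between x and y depends only on the
    direction of x - y, so the preferred directions form a convex cone K.  Fixing
    e1 > e0 and d = e1 - e0, continuity makes d an Archimedean order unit and K
    closed along d; hence every direction v has a unique r such that v - r d is
    neutral, and r is the affine utility U.  Closed contour sets make U weakly
    continuous.

    Put u z = U (Dirac z).  Then u is in C_b^psi by continuity of U at Dirac
    masses, and U mu is the integral of u because finitely supported measures
    are weakly dense: sort points according to finitely many test functions,
    send each cell to a representative, and apply dominated convergence.
    Concavity is risk aversion for the trivial sigma-algebra applied to
    measures with two atoms. *)

(** * Affine utilities on convex sets of functions *)

Definition mix {R : realType} {T : Type} (t : R) (x y : T -> R) : T -> R :=
  fun i => t * x i + (1 - t) * y i.

(** These are the basic neighbourhoods of [x] for pointwise convergence. On functionals induced by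
    measures in P^psi they give the psi-weak topology. *)
Definition agree {R : realType} {T : eqType} (fs : seq T) (e : R)
    (x y : T -> R) : Prop :=
  forall f, f \in fs -> `|y f - x f| < e.

Section mixtures.
Context {R : realType} {T : eqType}.
Implicit Types (x y : T -> R) (C : set (T -> R)).

Lemma mixxx (t : R) x : mix t x x = x.
Proof. by apply/funext => i; rewrite /mix; ring. Qed.

Lemma mix_sym (t : R) x y : mix (1 - t) x y = mix t y x.
Proof. by apply/funext => i; rewrite /mix; ring. Qed.

(** Only finitely many coordinates are constrained, so a segment starting at [x] stays in the
    neighbourhood for a positive time. *)
Lemma agree_mix (fs : seq T) (e : R) x y : 0 < e ->
  exists t0 : R, 0 < t0 < 1 /\
    forall t, 0 <= t <= t0 -> agree fs e x (mix t y x).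
Proof.
move=> e0; elim: fs => [|f fs [t0 [/andP[t00 t01] IH]]].
  by exists 2^-1; split; [lra|].
set M := `|y f - x f|; have M0 : 0 <= M by exact: normr_ge0.
(* From t (M + 1 + e) <= e it follows that t M < e. *)
exists (Num.min t0 (e / (M + 1 + e))); split.
  by rewrite lt_min gt_min t00 t01 /= andbT divr_gt0 //; lra.
move=> t /andP[t_ge0]; rewrite le_min => /andP[tt0 tM] g.
rewrite inE => /predU1P[->|gfs]; last by apply: IH => //; rewrite t_ge0.
have -> : mix t y x f - x f = t * (y f - x f) by rewrite /mix; ring.
rewrite normrM (ger0_norm t_ge0) -/M.
move: tM; rewrite ler_pdivlMr; last by lra.
nra.
Qed.

End mixtures.

Section affine_representation.
Context {R : realType} {T : eqType}.
Variables (C : set (T -> R)) (pref : (T -> R) -> (T -> R) -> Prop).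
Implicit Types x y z v w : T -> R.

Definition strict_pref x y := pref x y /\ ~ pref y x.

Hypothesis Cmix : forall (t : R) x y, 0 <= t <= 1 -> C x -> C y -> C (mix t x y).
Hypothesis pref_refl : forall x, C x -> pref x x.
Hypothesis pref_trans : forall x y z, C x -> C y -> C z ->
  pref x y -> pref y z -> pref x z.
Hypothesis pref_total : forall x y, C x -> C y -> pref x y \/ pref y x.
Hypothesis indep : forall x y z (t : R), C x -> C y -> C z -> 0 < t < 1 ->
  strict_pref x y -> strict_pref (mix t x z) (mix t y z).
Hypothesis upper_open : forall x z, C x -> C z -> strict_pref x z ->
  exists fs (e : R), 0 < e /\
    forall y, C y -> agree fs e x y -> strict_pref y z.
Hypothesis lower_open : forall x z, C x -> C z -> strict_pref z x ->
  exists fs (e : R), 0 < e /\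
    forall y, C y -> agree fs e x y -> strict_pref z y.

Let strictN x y : C x -> C y -> ~ pref x y -> strict_pref y x.
Proof. by move=> Cx Cy nxy; split=> //; case: (pref_total Cx Cy). Qed.

Let strict_trans x y z : C x -> C y -> C z ->
  strict_pref x y -> pref y z -> strict_pref x z.
Proof.
move=> Cx Cy Cz [xy nyx] yz; split; first exact: (pref_trans Cx Cy Cz).
by move=> zx; apply: nyx; exact: (pref_trans Cy Cz Cx).
Qed.

Let trans_strict x y z : C x -> C y -> C z ->
  pref x y -> strict_pref y z -> strict_pref x z.
Proof.
move=> Cx Cy Cz xy [yz nzy]; split; first exact: (pref_trans Cx Cy Cz).
by move=> zx; apply: nzy; exact: (pref_trans Cz Cx Cy).
Qed.

Lemma strict_mix_upper x y z : C x -> C y -> C z -> strict_pref x z ->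
  exists t0 : R, 0 < t0 < 1 /\
    forall t, 0 <= t <= t0 -> strict_pref (mix t y x) z.
Proof.
move=> Cx Cy Cz /(upper_open Cx Cz)[fs [e [e0 H]]].
have [t0 [t01 Ht]] := agree_mix fs x y e0; exists t0; split=> // t tt0.
by apply: H; [apply: Cmix => //; lra|exact: Ht].
Qed.

Lemma strict_mix_lower x y z : C x -> C y -> C z -> strict_pref z x ->
  exists t0 : R, 0 < t0 < 1 /\
    forall t, 0 <= t <= t0 -> strict_pref z (mix t y x).
Proof.
move=> Cx Cy Cz /(lower_open Cx Cz)[fs [e [e0 H]]].
have [t0 [t01 Ht]] := agree_mix fs x y e0; exists t0; split=> // t tt0.
by apply: H; [apply: Cmix => //; lra|exact: Ht].
Qed.

Let strict_mixl (t : R) x y : C x -> C y -> 0 < t < 1 -> strict_pref x y ->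
  strict_pref (mix t x y) y.
Proof. by move=> Cx Cy t01 /(indep Cx Cy Cy t01); rewrite mixxx. Qed.

Let strict_mixr (t : R) x y : C x -> C y -> 0 < t < 1 -> strict_pref x y ->
  strict_pref x (mix t y x).
Proof. by move=> Cx Cy t01 /(indep Cx Cy Cx t01); rewrite mixxx. Qed.

(* The independence axiom only speaks of strict preferences.  For x ~ y,
   perturb x upwards (or y downwards) a little and use continuity. *)
Lemma weak_indep x y z (t : R) : C x -> C y -> C z -> 0 < t < 1 -> pref x y ->
  pref (mix t x z) (mix t y z).
Proof.
move=> Cx Cy Cz t01 xy.
have t01' : 0 <= t <= 1 by lra.
have Cxz : C (mix t x z) by exact: Cmix.
have Cyz : C (mix t y z) by exact: Cmix.
have assoc e v w : mix e (mix t v z) (mix t w z) = mix t (mix e v w) z.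
  by apply/funext => i; rewrite /mix; ring.
apply: contrapT => nxy; have sp := strictN Cxz Cyz nxy.
have [[v [Cv vx]]|nov] := pselect (exists v, C v /\ strict_pref v x).
  have Cvz : C (mix t v z) by exact: Cmix.
  have [e [e01 He]] := strict_mix_lower Cxz Cvz Cyz sp.
  have Cev : C (mix e v x) by apply: Cmix => //; lra.
  have /He : 0 <= e <= e by lra.
  rewrite assoc => -[_]; apply.
  suff : strict_pref (mix e v x) y by move/(indep Cev Cy Cz t01) => [].
  by apply: (strict_trans Cev Cx Cy) => //; exact: strict_mixl.
have [[v [Cv yv]]|nov'] := pselect (exists v, C v /\ strict_pref y v).
  have Cvz : C (mix t v z) by exact: Cmix.
  have [e [e01 He]] := strict_mix_upper Cyz Cvz Cxz sp.
  have Cev : C (mix e v y) by apply: Cmix => //; lra.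
  have /He : 0 <= e <= e by lra.
  rewrite assoc => -[_]; apply.
  suff : strict_pref x (mix e v y) by move/(indep Cx Cev Cz t01) => [].
  by apply: (trans_strict Cx Cy Cev) => //; exact: strict_mixr.
(* In the remaining case [x] is maximal and [y] minimal in [C]. Once [y] is weakly preferred to [x],
   everything in [C] is indifferent. *)
have yx : pref y x.
  apply: contrapT => nyx; apply: nxy.
  by have [] : strict_pref (mix t x z) (mix t y z) by exact: indep.
apply: nxy; apply: (pref_trans Cxz Cy Cyz).
  by apply: contrapT => h; apply: nov'; exists (mix t x z); split => //; exact: strictN.
apply: (pref_trans Cy Cx Cyz) => //.
by apply: contrapT => h; apply: nov; exists (mix t y z); split => //; exact: strictN.
Qed.

(** The midpoint of [x] and [y] lies strictly between them, so each end can be perturbed separately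
    without crossing it. *)
Lemma strict_mix2 x y a b : C x -> C y -> C a -> C b -> strict_pref x y ->
  exists t0 : R, 0 < t0 < 1 /\
    forall t, 0 <= t <= t0 -> strict_pref (mix t a x) (mix t b y).
Proof.
move=> Cx Cy Ca Cb xy; pose m := mix (2^-1 : R) x y.
have h01 : 0 < (2^-1 : R) < 1 by lra.
have Cm : C m by apply: Cmix => //; lra.
have xm : strict_pref x m.
  have -> : m = mix (2^-1 : R) y x by rewrite /m -mix_sym; congr mix; field.
  exact: strict_mixr.
have my : strict_pref m y by exact: strict_mixl.
have [t1 [t101 H1]] := strict_mix_upper Cx Ca Cm xm.
have [t2 [t201 H2]] := strict_mix_lower Cy Cb Cm my.
exists (Num.min t1 t2); split; first by rewrite lt_min gt_min; lra.
move=> t; rewrite le_min => /and3P[t0 tt1 tt2].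
have Ca' : C (mix t a x) by apply: Cmix => //; lra.
have Cb' : C (mix t b y) by apply: Cmix => //; lra.
have [mb _] : strict_pref m (mix t b y) by apply: H2; lra.
by apply: (strict_trans Ca' Cm Cb') => //; apply: H1; lra.
Qed.

(** * The cone of preferred directions *)

Definition pref_cone v := exists (c : R) x y,
  [/\ 0 < c, C x, C y, pref x y & v = (fun f => c * (x f - y f))].

(** For nonempty convex [C] this is the linear span of C - C: a negative factor is absorbed by
    exchanging [x] and [y]. *)
Definition difference v := exists (c : R) x y,
  [/\ 0 < c, C x, C y & v = (fun f => c * (x f - y f))].

(** If x - y = c (z - w), the weight a = 1 / (1 + c) gives a y + (1 - a) z = a x + (1 - a) w. Were
    [y] strictly preferred to [x], independence would put this mixture strictly above a x + (1 - a)
    z, against weak independence applied to [z] and [w]. *)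
Lemma pref_coneP x y : C x -> C y -> pref_cone (fun f => x f - y f) -> pref x y.
Proof.
move=> Cx Cy [c [z [w [c0 Cz Cw zw E]]]]; apply: contrapT => nxy.
have yx := strictN Cx Cy nxy; pose a := (1 + c)^-1.
have a01 : 0 < a < 1 by rewrite invr_gt0 invf_lt1; lra.
have a01' : 0 < 1 - a < 1 by lra.
have E' : mix a y z = mix a x w.
  apply/funext => f; have := congr1 (@^~ f) E; rewrite /= => Ef.
  have xf : x f = y f + c * (z f - w f) by lra.
  by rewrite /mix xf /a; field; lra.
have [_] := indep Cy Cx Cz a01 yx; apply.
rewrite E' -(mix_sym a z x) -(mix_sym a w x).
have := weak_indep Cz Cw Cx a01' zw.
by rewrite !mix_sym.
Qed.

Lemma prefE x y : C x -> C y -> pref x y <-> pref_cone (fun f => x f - y f).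
Proof.
move=> Cx Cy; split=> [xy|]; last exact: pref_coneP.
by exists 1, x, y; split=> //; apply/funext => f; rewrite mul1r.
Qed.

Let combine (c c' : R) x y x' y' : 0 < c -> 0 < c' ->
  (fun f => c * (x f - y f) + c' * (x' f - y' f)) =
  (fun f => (c + c') * (mix (c / (c + c')) x x' f - mix (c / (c + c')) y y' f)).
Proof. by move=> c0 c'0; apply/funext => f; rewrite /mix; field; lra. Qed.

Let weight01 (c c' : R) : 0 < c -> 0 < c' -> 0 < c / (c + c') < 1.
Proof.
by move=> c0 c'0; rewrite divr_gt0 ?ltr_pdivrMr ?mul1r; lra.
Qed.

Lemma differenceD v w : difference v -> difference w ->
  difference (fun f => v f + w f).
Proof.
move=> [c [x [y [c0 Cx Cy ->]]]] [c' [x' [y' [c'0 Cx' Cy' ->]]]].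
have := weight01 c0 c'0; rewrite combine // => t01.
by eexists; eexists; eexists; split; [|apply: Cmix|apply: Cmix|reflexivity] => //; lra.
Qed.

Lemma differenceZ (a : R) v : difference v -> difference (fun f => a * v f).
Proof.
move=> [c [x [y [c0 Cx Cy ->]]]]; have [a0|a0|->] := ltgtP a 0.
- by exists (- a * c), y, x; split => //; [nra|apply/funext => f; ring].
- by exists (a * c), x, y; split => //; [nra|apply/funext => f; ring].
- by exists 1, x, x; split => //; apply/funext => f; ring.
Qed.

Lemma pref_coneD v w : pref_cone v -> pref_cone w ->
  pref_cone (fun f => v f + w f).
Proof.
move=> [c [x [y [c0 Cx Cy xy ->]]]] [c' [x' [y' [c'0 Cx' Cy' xy' ->]]]].
have := weight01 c0 c'0; rewrite combine //; set t := c / _ => t01.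
have Cm z z' : C z -> C z' -> C (mix t z z') by apply: Cmix; lra.
exists (c + c'), (mix t x x'), (mix t y y'); split; [lra|exact: Cm|exact: Cm| |by []].
(* First [x] is replaced by [y], then [x'] by [y']. *)
apply: (@pref_trans _ (mix t y x')); [exact: Cm|exact: Cm|exact: Cm| |].
  exact: weak_indep.
rewrite -(mix_sym t x' y) -(mix_sym t y' y); apply: weak_indep => //; lra.
Qed.

Lemma pref_coneZ (a : R) v : 0 < a -> pref_cone v -> pref_cone (fun f => a * v f).
Proof.
move=> a0 [c [x [y [c0 Cx Cy xy ->]]]]; exists (a * c), x, y.
by split => //; [nra|apply/funext => f; ring].
Qed.

Lemma pref_cone_total v : difference v ->
  pref_cone v \/ pref_cone (fun f => - v f).
Proof.
move=> [c [x [y [c0 Cx Cy ->]]]]; have [xy|yx] := pref_total Cx Cy.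
  by left; exists c, x, y.
by right; exists c, y, x; split => //; apply/funext => f; ring.
Qed.

(** * Measuring directions against a fixed strictly preferred one *)

Section scale.
Variables e1 e0 : T -> R.
Hypotheses (Ce1 : C e1) (Ce0 : C e0) (e10 : strict_pref e1 e0).
Let d f := e1 f - e0 f.

Let diff_d : difference d.
Proof. by exists 1, e1, e0; split => //; apply/funext => f; rewrite mul1r. Qed.

Let cone_d : pref_cone d.
Proof. by apply/prefE => //; case: e10. Qed.

Let coneN_d : ~ pref_cone (fun f => - d f).
Proof.
have -> : (fun f => - d f) = (fun f => e0 f - e1 f).
  by apply/funext => f; rewrite /d opprB.
by move/(prefE Ce0 Ce1); case: e10.
Qed.

Let cone0 : pref_cone (fun f => 0 : R).
Proof.
by exists 1, e1, e1; split=> //; [exact: pref_refl|apply/funext => f; ring].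
Qed.

Let cone_scale_d (r : R) : pref_cone (fun f => r * d f) <-> 0 <= r.
Proof.
split=> [H|].
  rewrite leNgt; apply/negP => r0; apply: coneN_d.
  have r1 : 0 < - r^-1 by rewrite oppr_gt0 invr_lt0.
  have := pref_coneZ r1 H; congr pref_cone.
  by apply/funext => f; field; lra.
rewrite le_eqVlt => /predU1P[<-|r0]; last exact: pref_coneZ.
by have := cone0; congr pref_cone; apply/funext => f; rewrite mul0r.
Qed.

(** With v = c (x - y), mixing a little of [x] into [e1] and of [y] into [e0] keeps the preference
    strict. The resulting direction t (x - y) + (1 - t) d is a positive multiple of s d + v. *)
Lemma pref_cone_archimedean v : difference v ->
  exists2 s : R, 0 < s & pref_cone (fun f => s * d f + v f).
Proof.
move=> [c [x [y [c0 Cx Cy ->]]]].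
have [t [t01 Ht]] := strict_mix2 Ce1 Ce0 Cx Cy e10.
exists (c * (1 - t) / t); first by rewrite divr_gt0 ?mulr_gt0 //; lra.
exists (c / t), (mix t x e1), (mix t y e0); split.
- by rewrite divr_gt0 //; lra.
- by apply: Cmix => //; lra.
- by apply: Cmix => //; lra.
- by have [] : strict_pref (mix t x e1) (mix t y e0) by apply: Ht; lra.
- by apply/funext => f; rewrite /mix /d; field; lra.
Qed.

(** If [y] were strictly above [x], it would remain so after mixing [e0] into [y] and [e1] into [x]
    with a small weight t. The hypothesis at e = c t / (1 - t) says the opposite. *)
Lemma pref_cone_closed v : difference v ->
  (forall e : R, 0 < e -> pref_cone (fun f => e * d f + v f)) -> pref_cone v.
Proof.
move=> [c [x [y [c0 Cx Cy ->]]]] H; exists c, x, y; split => //.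
apply: contrapT => nxy; have yx := strictN Cx Cy nxy.
have [t [t01 Ht]] := strict_mix2 Cy Cx Ce0 Ce1 yx.
have et : 0 < c * t / (1 - t) by rewrite divr_gt0 ?mulr_gt0 //; lra.
have [_] : strict_pref (mix t e0 y) (mix t e1 x) by apply: Ht; lra.
apply; apply: pref_coneP.
- by apply: Cmix => //; lra.
- by apply: Cmix => //; lra.
have a0 : 0 < (1 - t) / c by rewrite divr_gt0 //; lra.
have := pref_coneZ a0 (H _ et); congr pref_cone.
by apply/funext => f; rewrite /mix /d; field; lra.
Qed.

Let neutral v := pref_cone v /\ pref_cone (fun f => - v f).

(** The scale is the supremum of the r with v - r d in the cone. The Archimedean property for v
    makes this set nonempty, and for - v bounded above. Closedness puts the supremum in the set;
    just above it totality puts the opposite direction in the cone, and closedness applies again. *)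
Lemma scale_exists v : difference v ->
  exists r : R, neutral (fun f => v f - r * d f).
Proof.
move=> Dv; pose A := [set r : R | pref_cone (fun f => v f - r * d f)].
have Dr (r : R) : difference (fun f => v f - r * d f).
  have := differenceD Dv (differenceZ (- r) diff_d); congr difference.
  by apply/funext => f; ring.
have [s s0 Hs] := pref_cone_archimedean Dv.
have [s' s'0 Hs'] := pref_cone_archimedean (differenceZ (-1) Dv).
have As : A (- s).
  by move: Hs; congr pref_cone; apply/funext => f; ring.
have ubA : ubound A s'.
  move=> r Ar; rewrite -subr_ge0; apply/cone_scale_d.
  by have := pref_coneD Ar Hs'; congr pref_cone; apply/funext => f; ring.
have supA : has_sup A by split; [exists (- s)|exists s'].
exists (sup A); split.
  apply: pref_cone_closed => // e e_gt0.
  have [r Ar rA] := sup_adherent e_gt0 supA.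
  have er : 0 <= e - (sup A - r) by lra.
  have := pref_coneD Ar ((cone_scale_d _).2 er).
  by congr pref_cone; apply/funext => f; ring.
apply: pref_cone_closed.
  have := differenceZ (-1) (Dr (sup A)).
  by congr difference; apply/funext => f; ring.
move=> e e_gt0; have [Hr|Hr] := pref_cone_total (Dr (sup A + e)).
  have := sup_ubound (ex_intro _ s' ubA) Hr; lra.
by move: Hr; congr pref_cone; apply/funext => f; ring.
Qed.

Lemma neutralD v w : neutral v -> neutral w -> neutral (fun f => v f + w f).
Proof.
move=> [v1 v2] [w1 w2]; split; first exact: pref_coneD.
by have := pref_coneD v2 w2; congr pref_cone; apply/funext => f; ring.
Qed.

Lemma neutralZ (a : R) v : neutral v -> neutral (fun f => a * v f).
Proof.
move=> [v1 v2]; have [a0|a0|->] := ltgtP a 0.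
- have a0' : 0 < - a by lra.
  split; [have := pref_coneZ a0' v2|have := pref_coneZ a0' v1];
  by congr pref_cone; apply/funext => f; ring.
- split; first exact: pref_coneZ.
  by have := pref_coneZ a0 v2; congr pref_cone; apply/funext => f; ring.
- by split; have := cone0; congr pref_cone; apply/funext => f; ring.
Qed.

Lemma affine_representation_nontrivial : exists U : (T -> R) -> R,
  (forall (t : R) x y, 0 <= t <= 1 -> C x -> C y ->
     U (mix t x y) = t * U x + (1 - t) * U y) /\
  (forall x y, C x -> C y -> (pref x y <-> U y <= U x)).
Proof.
(* [U x] is the scale of x - e0; off [C] its value is arbitrary. *)
have ex x : exists r : R, C x -> neutral (fun f => (x f - e0 f) - r * d f).
  have [Cx|nCx] := pselect (C x); last by exists 0.
  have [|r Hr] := @scale_exists (fun f => x f - e0 f); last by exists r.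
  by exists 1, x, e0; split => //; apply/funext => f; rewrite mul1r.
have [U HU] := choice ex; exists U.
(* Modulo neutral directions x - y is (a - b) d, which lies in the cone exactly when a - b >= 0. *)
have key x y (a b : R) : neutral (fun f => x f - a * d f) ->
    neutral (fun f => y f - b * d f) ->
    pref_cone (fun f => x f - y f) <-> b <= a.
  move=> [x1 x2] [y1 y2]; rewrite -subr_ge0 -cone_scale_d; split=> H.
    have := pref_coneD (pref_coneD x2 y1) H.
    by congr pref_cone; apply/funext => f; ring.
  have := pref_coneD (pref_coneD x1 y2) H.
  by congr pref_cone; apply/funext => f; ring.
split=> [t x y t01 Cx Cy|x y Cx Cy]; last first.
  rewrite (prefE Cx Cy) -(key _ _ _ _ (HU _ Cx) (HU _ Cy)).
  by split; congr pref_cone; apply/funext => f; ring.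
have N1 := HU _ (Cmix t01 Cx Cy).
have N2 : neutral (fun f => (mix t x y f - e0 f) - (t * U x + (1 - t) * U y) * d f).
  have := neutralD (neutralZ t (HU _ Cx)) (neutralZ (1 - t) (HU _ Cy)).
  by congr neutral; apply/funext => f; rewrite /mix; ring.
have H0 : pref_cone (fun f => (mix t x y f - e0 f) - (mix t x y f - e0 f)).
  by have := cone0; congr pref_cone; apply/funext => f; ring.
apply/eqP; rewrite eq_le; apply/andP; split.
  exact/(key _ _ _ _ N2 N1).
exact/(key _ _ _ _ N1 N2).
Qed.

End scale.

Theorem affine_representation : exists U : (T -> R) -> R,
  [/\ forall (t : R) x y, 0 <= t <= 1 -> C x -> C y ->
       U (mix t x y) = t * U x + (1 - t) * U y,
     forall x y, C x -> C y -> (pref x y <-> U y <= U x) &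
     forall x (e : R), C x -> 0 < e -> exists fs (e' : R), 0 < e' /\
       forall y, C y -> agree fs e' x y -> `|U y - U x| < e].
Proof.
have [[e1 [e0 [Ce1 Ce0 e10]]]|triv] :=
    pselect (exists e1 e0, [/\ C e1, C e0 & strict_pref e1 e0]); last first.
  exists (fun=> 0); split.
  - by move=> *; ring.
  - move=> x y Cx Cy; split=> // _; apply: contrapT => nxy; apply: triv.
    by exists y, x; split => //; exact: strictN.
  - by move=> x e Cx e0; exists [::], 1; split => // y _ _; rewrite subrr normr0.
have [U [Uaff Urep]] := affine_representation_nontrivial Ce1 Ce0 e10.
exists U; split => // x e Cx e_gt0.
have Us y z : C y -> C z -> strict_pref y z <-> U z < U y.
  move=> Cy Cz; split=> [[_ nzy]|zy].
    by rewrite ltNge; apply/negP => /(Urep _ _ Cz Cy).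
  by apply: strictN => //; move/(Urep _ _ Cz Cy); rewrite leNgt zy.
have small (a : R) : exists2 t : R, 0 < t < 1 & t * `|a| < e.
  have a0 := normr_ge0 a; exists (e / (`|a| + 1 + e)).
    by rewrite divr_gt0 ?ltr_pdivrMr ?mul1r; lra.
  by rewrite mulrAC ltr_pdivrMr; nra.
(* If something beats [x], moving [x] slightly towards it reaches a utility strictly between U x and
   U x + e, and the points strictly worse than that mixture contain a neighbourhood of [x]. If
   nothing beats [x], there is nothing to control. *)
have upper : exists fs (e' : R), 0 < e' /\
    forall y, C y -> agree fs e' x y -> U y < U x + e.
  have [[a [Ca xa]]|noa] := pselect (exists a, C a /\ U x < U a); last first.
    exists [::], 1; split=> // y Cy _; rewrite ltNge; apply/negP => h.
    by apply: noa; exists y; split => //; lra.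
  have [t t01 ht] := small (U a - U x).
  have t01' : 0 <= t <= 1 by lra.
  have Cm := Cmix t01' Ca Cx.
  have Um := Uaff _ _ _ t01' Ca Cx.
  have h0 : U x < U (mix t a x) by rewrite Um; nra.
  have [fs [e' [e'0 H]]] := lower_open Cx Cm ((Us _ _ Cm Cx).2 h0).
  exists fs, e'; split => // y Cy /(H y Cy) /(Us _ _ Cm Cy); rewrite Um.
  by move: ht; rewrite ger0_norm; nra.
have lower : exists fs (e' : R), 0 < e' /\
    forall y, C y -> agree fs e' x y -> U x - e < U y.
  have [[a [Ca xa]]|noa] := pselect (exists a, C a /\ U a < U x); last first.
    exists [::], 1; split=> // y Cy _; rewrite ltNge; apply/negP => h.
    by apply: noa; exists y; split => //; lra.
  have [t t01 ht] := small (U a - U x).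
  have t01' : 0 <= t <= 1 by lra.
  have Cm := Cmix t01' Ca Cx.
  have Um := Uaff _ _ _ t01' Ca Cx.
  have h0 : U (mix t a x) < U x by rewrite Um; nra.
  have [fs [e' [e'0 H]]] := upper_open Cx Cm ((Us _ _ Cx Cm).2 h0).
  exists fs, e'; split => // y Cy /(H y Cy) /(Us _ _ Cy Cm); rewrite Um.
  by move: ht; rewrite ltr0_norm; nra.
have [fs1 [d1 [d10 H1]]] := upper; have [fs2 [d2 [d20 H2]]] := lower.
exists (fs1 ++ fs2), (Num.min d1 d2); split; first by rewrite lt_min d10.
move=> y Cy xy.
have : U y < U x + e.
  apply: H1 => // f ff; have := xy f.
  by rewrite mem_cat ff lt_min => /(_ erefl)/andP[].
have : U x - e < U y.
  apply: H2 => // f ff; have := xy f.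
  by rewrite mem_cat ff orbT lt_min => /(_ erefl)/andP[].
by rewrite ltr_norml; lra.
Qed.

End affine_representation.

(** * Affinity on finite convex combinations *)

Section finite_mixtures.
Context {R : realType} {T : Type}.
Variables (C : set (T -> R)) (U : (T -> R) -> R).
Hypothesis Cmix : forall (t : R) x y, 0 <= t <= 1 -> C x -> C y -> C (mix t x y).
Hypothesis Uaff : forall (t : R) x y, 0 <= t <= 1 -> C x -> C y ->
  U (mix t x y) = t * U x + (1 - t) * U y.

(** Giving the missing mass to [z] lets the induction run on sublists, whose weights do not add up
    to 1: the head point is merged into [z] with a weight t such that w i = t (1 - W). *)
Let sub_mixture (I : Type) (s : seq I) (w : I -> R) (x : I -> T -> R) z :
  (forall i, 0 <= w i) -> \sum_(i <- s) w i <= 1 -> (forall i, C (x i)) -> C z ->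
  let m f := \sum_(i <- s) w i * x i f + (1 - \sum_(i <- s) w i) * z f in
  C m /\ U m = \sum_(i <- s) w i * U (x i) + (1 - \sum_(i <- s) w i) * U z.
Proof.
move=> w0 w1 Cx; elim: s w1 z => [|i s IH] w1 z Cz m.
  have -> : m = z by apply/funext => f; rewrite /m !big_nil; ring.
  by rewrite !big_nil; split=> //; ring.
have wi := w0 i; move: w1; rewrite big_cons => w1.
pose W := \sum_(j <- s) w j.
have W1 : W <= 1 by rewrite /W; lra.
have E : exists2 t : R, 0 <= t <= 1 & w i = t * (1 - W).
  (* If the tail already has mass 1, then w i = 0. *)
  have [W0|W0] := eqVneq (1 - W) 0; first by exists 0; rewrite /W in W0 *; lra.
  have W0' : 0 < 1 - W by rewrite lt_def W0; lra.
  exists (w i / (1 - W)); last by field.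
  by rewrite divr_ge0 ?ler_pdivrMr ?mul1r //; rewrite /W in W0' *; lra.
have [t t01 wiE] := E.
have [] := IH W1 (mix t (x i) z) (Cmix t01 (Cx i) Cz); rewrite /= -/W Uaff // => C1 U1.
have -> : m = (fun f => \sum_(j <- s) w j * x j f + (1 - W) * mix t (x i) z f).
  by apply/funext => f; rewrite /m !big_cons -/W wiE /mix; ring.
by split=> //; rewrite U1 !big_cons wiE -/W; ring.
Qed.

Lemma finite_mixture (I : Type) (s : seq I) (w : I -> R) (x : I -> T -> R) :
  (forall i, 0 <= w i) -> \sum_(i <- s) w i = 1 -> (forall i, C (x i)) ->
  let m f := \sum_(i <- s) w i * x i f in
  C m /\ U m = \sum_(i <- s) w i * U (x i).
Proof.
case: s => [|i s] w0 w1 Cx /=; first by rewrite big_nil in w1; lra.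
have [|] := sub_mixture w0 _ Cx (Cx i) (s := i :: s); first by rewrite w1.
rewrite /= w1 subrr mul0r addr0.
have -> : (fun f => \sum_(j <- i :: s) w j * x j f + 0 * x i f) =
    (fun f => \sum_(j <- i :: s) w j * x j f).
  by apply/funext => f; rewrite mul0r addr0.
by [].
Qed.

End finite_mixtures.

(** * Integral functionals of measures *)

Section mixture_measure.
Context d (T : measurableType d) (R : realType).
Variables (a b : {nonneg R}) (ab1 : a%:num + b%:num = 1).
Variables mu nu : probability T R.

(** The proof that the weights add up to 1 is an argument so that the probability instance can be
    attached to the term itself. *)
Definition mixture_measure (_ : a%:num + b%:num = 1) : set T -> \bar R :=
  measure_add (mscale a mu) (mscale b nu).

HB.instance Definition _ := Measure.on (mixture_measure ab1).

Let mixture_setT : mixture_measure ab1 setT = 1%E.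
Proof.
transitivity (a%:num%:E * mu setT + b%:num%:E * nu setT)%E.
  by rewrite /mixture_measure measure_addE.
by rewrite !probability_setT !mule1 -EFinD ab1.
Qed.

HB.instance Definition _ :=
  Measure_isProbability.Build _ _ _ (mixture_measure ab1) mixture_setT.

End mixture_measure.

(** * The weight psi_p and the space C_b^psi *)

Section weight_function.
Context {R : realType} {S : normedModType R}.
Variable p : R.
Hypothesis p1 : 1 <= p.

Let p_neq0 : p != 0.
Proof. by rewrite gt_eqF // (lt_le_trans ltr01). Qed.

Lemma psi_p_ge1 (z : S) : 1 <= psi_p p z.
Proof. by rewrite /psi_p lerDl powR_ge0. Qed.

Lemma psi_p_gt0 (z : S) : 0 < psi_p p z.
Proof. exact: lt_le_trans (psi_p_ge1 z). Qed.

Lemma psi_p0 : psi_p p (0 : S) = 1.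
Proof. by rewrite /psi_p normr0 powR0 ?addr0. Qed.

Lemma continuous_psi_p : continuous (psi_p p : S -> R).
Proof.
move=> z; rewrite /psi_p; apply: cvgD; first exact: cvg_cst.
(* At 0, where differentiability of the power is not at hand, p >= 1 gives |w|^p <= |w| for |w| <=
   1. *)
have [->|z0] := eqVneq z 0.
  rewrite normr0 powR0 //.
  apply/cvgrPdist_lt => e e0; near=> w.
  rewrite sub0r normrN ger0_norm ?powR_ge0 //.
  have [->|w0] := eqVneq w 0; first by rewrite normr0 powR0.
  have w1 : `|w| <= 1 by near: w; exact: nbhs0_le.
  apply: (@le_lt_trans _ _ `|w|); first by rewrite ge1r_powR // normr_gt0 w0.
  by near: w; exact: nbhs0_lt.
apply: (@continuous_comp _ _ _ (fun w : S => `|w|) (fun a : R => a `^ p)).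
  exact: norm_continuous.
apply: differentiable_continuous; apply/derivable1_diffP.
by apply: derivable_powR; rewrite in_itv /= andbT normr_gt0.
Unshelve. all: by end_near. Qed.

Lemma continuous_measurable_Borel (f : S -> R) : continuous f ->
  measurable_fun setT (f : Borel S -> R).
Proof.
move=> /continuousP cf; apply: (measurability _ (RGenOpens.measurableE R)).
move=> _ [_ [a [b ->] <-]]; rewrite setTI; apply: sub_sigma_algebra.
exact/cf/interval_open.
Qed.

Lemma Cbpsi_continuous (f : S -> R) : Cbpsi (psi_p p) f -> continuous f.
Proof.
move=> [cf _] z.
have -> : f = (fun w => (f w / psi_p p w) * psi_p p w).
  by apply/funext => w; rewrite divfK // gt_eqF // psi_p_gt0.
by apply: cvgM; [exact: cf|exact: continuous_psi_p].
Qed.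

Lemma Cbpsi_measurable (f : S -> R) : Cbpsi (psi_p p) f ->
  measurable_fun setT (f : Borel S -> R).
Proof. by move/Cbpsi_continuous/continuous_measurable_Borel. Qed.

Lemma Cbpsi_bound (f : S -> R) : Cbpsi (psi_p p) f ->
  exists2 M : R, 0 <= M & forall z, `|f z| <= M * psi_p p z.
Proof.
move=> [_ [M HM]]; exists `|M| => // z; have := HM z.
rewrite normrM normfV (gtr0_norm (psi_p_gt0 z)) ler_pdivrMr ?psi_p_gt0 //.
by move/le_trans; apply; rewrite ler_wpM2r ?ler_norm // ltW // psi_p_gt0.
Qed.

Lemma CbpsiP (f : S -> R) (M : R) : continuous f ->
  (forall z, `|f z| <= M * psi_p p z) -> Cbpsi (psi_p p) f.
Proof.
move=> cf HM; split=> [z|].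
  apply: cvgM; first exact: cf.
  by apply: cvgV; [rewrite gt_eqF // psi_p_gt0|exact: continuous_psi_p].
exists M => z; rewrite normrM normfV (gtr0_norm (psi_p_gt0 z)).
by rewrite ler_pdivrMr ?psi_p_gt0.
Qed.

Lemma Cbpsi_psi : Cbpsi (psi_p p) (psi_p p : S -> R).
Proof.
apply: (@CbpsiP _ 1); first exact: continuous_psi_p.
by move=> z; rewrite mul1r (gtr0_norm (psi_p_gt0 z)).
Qed.

End weight_function.

Section integral_functionals.
Context {R : realType} {S : completeNormedModType R}.
Variable p : R.
Hypothesis p1 : 1 <= p.
Local Notation psi := (psi_p p : S -> R).
Local Notation P := (probability (Borel S) R).
Implicit Types mu nu lam : P.

(* Set to 0 off C_b^psi, so that mixtures of measures induce mixtures of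
   functionals on all of S -> R. *)
Definition functional_of mu : (S -> R) -> R :=
  fun f => if `[< Cbpsi psi f >] then fine (\int[mu]_x (f x)%:E) else 0.

Lemma functional_ofE mu f : Ppsi psi mu -> Cbpsi psi f ->
  (functional_of mu f)%:E = (\int[mu]_x (f x)%:E)%E.
Proof.
move=> Pmu Cf; rewrite /functional_of asboolT // fineK //.
exact/integrable_fin_num/Pmu.
Qed.

Lemma functional_of_out mu f : ~ Cbpsi psi f -> functional_of mu f = 0.
Proof. by move=> Cf; rewrite /functional_of asboolF. Qed.

Lemma Ppsi_dirac (z : S) : Ppsi psi (\d_(z : Borel S) : P).
Proof.
move=> f /(Cbpsi_measurable p1) mf; apply/integrableP.
split; first exact/measurable_EFinP.
rewrite integral_dirac //; last first.
  by apply: measurableT_comp => //; exact/measurable_EFinP.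
by rewrite diracT mul1e /= ltry.
Qed.

Lemma functional_of_dirac (z : S) f : Cbpsi psi f ->
  functional_of (\d_(z : Borel S) : P) f = f z.
Proof.
move=> Cf; rewrite /functional_of asboolT // integral_dirac //.
  by rewrite diracT mul1e.
by apply/measurable_EFinP; exact: (Cbpsi_measurable p1).
Qed.

Lemma is_mixture_exists (t : R) mu nu : 0 <= t <= 1 -> exists m, is_mixture t mu nu m.
Proof.
move=> /andP[t0 t1]; have t1' : 0 <= 1 - t by lra.
have ab1 : (NngNum t0)%:num + (NngNum t1')%:num = 1 by rewrite /=; ring.
exists (mixture_measure mu nu ab1 : P) => A mA.
by rewrite /= /mixture_measure measure_addE.
Qed.

Lemma is_mixture_ge0_integral (t : R) mu nu m (g : Borel S -> \bar R) :
  0 <= t <= 1 -> is_mixture t mu nu m ->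
  measurable_fun setT g -> (forall x, 0 <= g x)%E ->
  (\int[m]_x g x = t%:E * \int[mu]_x g x + (1 - t)%:E * \int[nu]_x g x)%E.
Proof.
move=> /andP[t0 t1] mm mg g0; have t1' : 0 <= 1 - t by lra.
pose m' := measure_add (mscale (NngNum t0) mu) (mscale (NngNum t1') nu).
rewrite (eq_measure_integral m'); last first.
  move=> A mA _; transitivity (t%:E * mu A + (1 - t)%:E * nu A)%E; first exact: mm.
  exact/esym/(measure_addE (mscale (NngNum t0) mu) (mscale (NngNum t1') nu)).
by rewrite ge0_integral_measure_add // !ge0_integral_mscale.
Qed.

Lemma is_mixture_integrable (t : R) mu nu m f : 0 <= t <= 1 -> is_mixture t mu nu m ->
  mu.-integrable setT (fun x : Borel S => (f x)%:E) ->
  nu.-integrable setT (fun x : Borel S => (f x)%:E) ->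
  m.-integrable setT (fun x : Borel S => (f x)%:E) /\
  (\int[m]_x (f x)%:E =
    t%:E * \int[mu]_x (f x)%:E + (1 - t)%:E * \int[nu]_x (f x)%:E)%E.
Proof.
move=> t01 mm imu inu; have mf := measurable_int _ imu.
have mE := is_mixture_ge0_integral t01 mm.
have [_ fmu] := integrableP _ _ _ imu; have [_ fnu] := integrableP _ _ _ inu.
have [t0 t1] : 0 <= t /\ 0 <= 1 - t by lra.
split.
  apply/integrableP; split => //; rewrite mE //; last exact: measurableT_comp.
  by apply: lte_add_pinfty; apply: lte_mul_pinfty.
(* The nonnegative case applies to the positive and negative parts; all four integrals are finite,
   so the identity reduces to one in [R]. *)
rewrite integralE [X in (_ * X + _)%E]integralE [X in (_ + _ * X)%E]integralE.
rewrite !mE //; [|exact: measurable_funeneg|exact: measurable_funepos].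
have /fineK <- := integrable_fin_num measurableT (integrable_funepos measurableT imu).
have /fineK <- := integrable_fin_num measurableT (integrable_funepos measurableT inu).
have /fineK <- := integrable_fin_num measurableT (integrable_funeneg measurableT imu).
have /fineK <- := integrable_fin_num measurableT (integrable_funeneg measurableT inu).
rewrite -!(EFinM, EFinD, EFinB); congr EFin; ring.
Qed.

Lemma is_mixture_Ppsi (t : R) mu nu m : 0 <= t <= 1 -> is_mixture t mu nu m ->
  Ppsi psi mu -> Ppsi psi nu -> Ppsi psi m.
Proof.
move=> t01 mm Pmu Pnu f Cf.
by have [] := is_mixture_integrable t01 mm (Pmu f Cf) (Pnu f Cf).
Qed.

Lemma functional_of_mix (t : R) mu nu m : 0 <= t <= 1 -> is_mixture t mu nu m ->
  Ppsi psi mu -> Ppsi psi nu ->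
  functional_of m = mix t (functional_of mu) (functional_of nu).
Proof.
move=> t01 mm Pmu Pnu; apply/funext => f; rewrite /mix.
have [Cf|Cf] := pselect (Cbpsi psi f); last by rewrite !functional_of_out //; ring.
have [_ E] := is_mixture_integrable t01 mm (Pmu f Cf) (Pnu f Cf).
apply: EFin_inj; rewrite EFinD !EFinM !functional_ofE //.
exact: is_mixture_Ppsi mm _ _.
Qed.

End integral_functionals.

(** * Density of finitely supported measures *)

Lemma near_forall_seq (X : Type) (F : set_system X) (I : eqType) (s : seq I)
    (Q : I -> X -> Prop) : Filter F ->
  (forall i, i \in s -> \forall x \near F, Q i x) ->
  \forall x \near F, forall i, i \in s -> Q i x.
Proof.
move=> FF; elim: s => [|i s IH] H; first exact: nearW.
have H1 := H i (mem_head _ _).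
have H2 := IH (fun j js => H j (mem_behead (s := i :: s) js)).
by apply: filterS2 H1 H2 => x Qi Qs j; rewrite inE => /predU1P[->|/Qs].
Qed.

Section finite_range_approximation.
Context {R : realType} {S : completeNormedModType R}.
Variable p : R.
Hypothesis p1 : 1 <= p.
Local Notation psi := (psi_p p : S -> R).
Implicit Types (f : S -> R) (mu : probability (Borel S) R).

(** Factoring through a finite type of measurable cells turns integrals along [h] into sums over
    [K]. *)
Definition finite_range (h : S -> S) :=
  exists (K : finType) (key : S -> K) (rep : K -> S),
  (forall k, measurable (key @^-1` [set k] : set (Borel S))) /\ h = rep \o key.

Lemma measurable_gt_set f (c : R) : measurable_fun setT (f : Borel S -> R) ->
  measurable ([set z | c < f z] : set (Borel S)).
Proof.
move=> mf; rewrite -[X in measurable X]setTI.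
have := mf measurableT _ (measurable_itv `]c, +oo[).
by congr (measurable (_ `&` _)); apply/seteqP; split => z /=; rewrite in_itv /= andbT.
Qed.

Lemma measurable_signature (s : seq ((S -> R) * R)) (k : seq bool) :
  (forall q, q \in s -> measurable_fun setT (q.1 : Borel S -> R)) ->
  measurable ([set z | [seq q.2 < q.1 z | q <- s] = k] : set (Borel S)).
Proof.
elim: s k => [|[f c] s IH] [|b k] ms /=.
- rewrite (_ : [set _ | _] = setT) //; by apply/seteqP; split.
- rewrite (_ : [set _ | _] = set0) //; by apply/seteqP; split.
- rewrite (_ : [set _ | _] = set0) //; by apply/seteqP; split.
have mf := measurable_gt_set c (ms (f, c) (mem_head _ _)).
have mt := IH k (fun q qs => ms q (mem_behead (s := (f, c) :: s) qs)).
rewrite (_ : [set _ | _] = (if b then [set z | c < f z] else ~` [set z | c < f z]) `&`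
   [set z | [seq q.2 < q.1 z | q <- s] = k]).
  apply: measurableI => //; case: b => //; exact: measurableC.
apply/seteqP; split => z /=.
  by move=> [<- <-]; split => //; case: ifP => //= /negP.
by move=> [+ ->]; case: b => /= [->|/negP/negbTE ->].
Qed.

(* Two values in [-N, N] more than e apart are separated by a threshold
   - N + e * j; the key records all comparisons with the thresholds. *)
Lemma finite_key (fs : seq (S -> R)) (N e : R) : 0 < e ->
  (forall f, f \in fs -> measurable_fun setT (f : Borel S -> R)) ->
  exists (K : finType) (key : S -> K),
    (forall k, measurable (key @^-1` [set k] : set (Borel S))) /\
    forall f z w, f \in fs -> key z = key w -> `|f z| <= N -> `|f w| <= N ->
      `|f z - f w| <= e.
Proof.
move=> e0 mfs; pose c (j : nat) := - N + e * j%:R.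
pose s := [seq (f, c j) | f <- fs, j <- iota 0 (Num.truncn (2 * N / e)).+2].
exists ((size s).-tuple bool),
  (fun z => map_tuple (fun q : (S -> R) * R => q.2 < q.1 z) (in_tuple s)); split.
  move=> k; have -> : (fun z => map_tuple (fun q : (S -> R) * R => q.2 < q.1 z)
      (in_tuple s)) @^-1` [set k] = [set z | [seq q.2 < q.1 z | q <- s] = k].
    by apply/seteqP; split => z /= => [<-//|zk]; exact/val_inj.
  apply: measurable_signature => q /allpairsP[[f j] [/= ffs _ ->]] /=.
  exact: mfs.
have le f z w : f \in fs -> [seq q.2 < q.1 z | q <- s] = [seq q.2 < q.1 w | q <- s] ->
    `|f z| <= N -> `|f w| <= N -> f w - f z <= e.
  move=> ffs /eq_in_map E fz fw; rewrite leNgt; apply/negP => h.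
  move: fz fw; rewrite !ler_norml => /andP[fz1 fz2] /andP[fw1 fw2].
  (* [a] is the position of f z in units of e. The next threshold, of index truncn a + 1, is above f
     z by at most e, hence below f w. Since a <= 2 N / e, this index is on the list of length truncn
     (2 N / e) + 2. *)
  pose a := (f z + N) / e.
  have a0 : 0 <= a by rewrite divr_ge0 //; lra.
  have aN : a <= 2 * N / e by rewrite ler_pM2r ?invr_gt0 //; lra.
  have /andP[ta1 ta2] := Num.Theory.truncn_itv a0.
  have ae : a * e = f z + N by rewrite /a divfK // gt_eqF.
  have ms : (f, c (Num.truncn a).+1) \in s.
    apply/allpairsP; exists (f, (Num.truncn a).+1); split => //.
    by rewrite mem_iota add0n !ltnS le_truncn.
  have := E _ ms; rewrite /= /c.
  have -> : (- N + e * (Num.truncn a).+1%:R < f w) = true.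
    by rewrite -natr1; nra.
  have -> // : (- N + e * (Num.truncn a).+1%:R < f z) = false.
  apply/negbTE; rewrite -leNgt; nra.
move=> f z w ffs /(congr1 val) /= E fz fw.
rewrite ler_norml; have := le f z w ffs E fz fw; have := le f w z ffs (esym E) fw fz.
lra.
Qed.

Lemma Cbpsi_common_bound (fs : seq (S -> R)) :
  (forall f, f \in fs -> Cbpsi psi f) ->
  exists2 M : R, 0 <= M & forall f, f \in fs -> forall z, `|f z| <= M * psi z.
Proof.
elim: fs => [|f fs IH] Cfs; first by exists 0.
have [M M0 HM] := IH (fun g gfs => Cfs g (mem_behead (s := f :: fs) gfs)).
have [M' M'0 HM'] := Cbpsi_bound (Cfs f (mem_head _ _)).
exists (M + M'); first by lra.
move=> g; rewrite inE => gf z; have pz := psi_p_gt0 p z.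
move: gf => /predU1P[->|gfs].
  apply: le_trans (HM' z) _; rewrite ler_pM2r //; lra.
apply: le_trans (HM g gfs z) _; rewrite ler_pM2r //; lra.
Qed.

(** On the sublevel set psi <= n the functions are bounded by M n, so [finite_key] cuts it into
    cells on which they barely vary, and each cell goes to one of its own points. The rest of the
    space goes to 0. *)
Lemma finite_range_step (fs : seq (S -> R)) (n : nat) :
  (forall f, f \in fs -> Cbpsi psi f) ->
  exists h : S -> S, [/\ finite_range h,
    forall z, psi z <= n%:R -> forall f, f \in fs -> `|f (h z) - f z| <= n.+1%:R^-1 &
    forall z, n%:R < psi z -> h z = 0].
Proof.
move=> Cfs; have [M M0 HM] := Cbpsi_common_bound Cfs.
have [|f ffs|K [key [mkey Hkey]]] := @finite_key fs (M * n%:R) n.+1%:R^-1.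
- by rewrite invr_gt0 ltr0n.
- exact: (Cbpsi_measurable p1 (Cfs _ ffs)).
pose key' (z : S) : bool * K := (n%:R < psi z, key z).
pose rep (k : bool * K) : S :=
  (* The default of [xget] concerns only cells that miss the sublevel set. *)
  if k.1 then 0 else xget 0 [set w | psi w <= n%:R /\ key w = k.2].
exists (rep \o key'); split.
- exists (bool * K)%type, key', rep; split => // -[b k].
  have mp := measurable_gt_set n%:R (Cbpsi_measurable p1 (Cbpsi_psi p1)).
  have -> : key' @^-1` [set (b, k)] =
      (if b then [set z | n%:R < psi z] else ~` [set z | n%:R < psi z]) `&`
      (key @^-1` [set k]).
    apply/seteqP; split => z /=.
      by move=> [<- <-]; split => //; case: ifP => //= /negP.
    by rewrite /key' => -[+ ->]; case: b => /= [->|/negP/negbTE ->].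
  by apply: measurableI => //; case: b => //; exact: measurableC.
- move=> z zn f ffs; rewrite /= /rep /key' /= ltNge zn /=.
  case: xgetP => [w _ [wn kw]|/(_ z)[]]; last by [].
  have bd x : psi x <= n%:R -> `|f x| <= M * n%:R.
    by move=> xn; apply: le_trans (HM f ffs x) _; rewrite ler_wpM2l.
  by apply: Hkey => //; exact: bd.
- by move=> z zn; rewrite /= /rep /key' /= zn.
Qed.

Lemma finite_range_integral (h : S -> S) mu : finite_range h ->
  exists (K : finType) (w : K -> R) (r : K -> S),
  [/\ forall k, 0 <= w k, \sum_k w k = 1 & forall f : S -> R,
    measurable_fun setT (f \o h : Borel S -> R) /\
    (\int[mu]_x (f (h x))%:E = (\sum_k w k * f (r k))%:E)%E].
Proof.
move=> [K [key [rep [mkey ->]]]].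
pose A k : set (Borel S) := key @^-1` [set k].
have E f : (fun x : Borel S => (f (rep (key x)))%:E) =
    (fun x : Borel S => (\sum_(k : K) (f (rep k))%:E * (\1_(A k) x : R)%:E)%E).
  apply/funext => x; rewrite (bigD1 (key x)) //= big1 ?adde0.
    by rewrite indicE mem_set // mule1.
  move=> k /eqP kx; rewrite indicE memNset ?mule0 //.
  by move=> /= xk; apply: kx.
have I f k : mu.-integrable setT (fun x => (f (rep k))%:E * (\1_(A k) x : R)%:E)%E.
  by apply: integrableZl => //; apply: integrable_indic; exact: mkey.
pose w k : R := fine (mu (A k)).
have Iw f : (\int[mu]_x (f (rep (key x)))%:E = (\sum_k w k * f (rep k))%:E)%E.
  rewrite E integral_sum // -sumEFin; apply: eq_bigr => k _.
  rewrite integralZl //; last by apply: integrable_indic; exact: mkey.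
  rewrite integral_indic //; last exact: mkey.
  by rewrite setIT EFinM /w fineK ?fin_num_measure 1?muleC //; exact: mkey.
exists K, w, rep; split => [k||f].
- exact: fine_ge0.
(* The total weight is read off from the integral of the constant 1. *)
- have T1 : (\int[mu]_(x in setT) (1 : R)%:E = 1%:E)%E.
    by rewrite integral_cst // mul1e; exact: probability_setT.
  have := Iw (fun=> 1); rewrite T1 => -[->].
  by apply: eq_bigr => k _; rewrite mulr1.
- split => //; apply/measurable_EFinP.
  have -> : EFin \o (f \o (rep \o key)) =
    (fun x : Borel S => (f (rep (key x)))%:E) by [].
  rewrite E; apply: (measurable_int mu).
  by apply: integrable_sum.
Qed.

Theorem finite_support_dense mu (fs : seq (S -> R)) (e : R) : Ppsi psi mu -> 0 < e ->
  (forall f, f \in fs -> Cbpsi psi f) ->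
  exists (K : finType) (w : K -> R) (r : K -> S),
  [/\ forall k, 0 <= w k, \sum_k w k = 1 & forall f, f \in fs ->
    `|\sum_k w k * f (r k) - functional_of p mu f| < e].
Proof.
move=> Pmu e0 Cfs.
(* Adding psi to the test functions keeps psi (h n x) <= psi x + 1 <= 2 psi x on the sublevel set,
   which yields the dominating function 2 M psi. *)
have Cpfs f : f \in psi :: fs -> Cbpsi psi f.
  by rewrite inE => /predU1P[->|/Cfs //]; exact: Cbpsi_psi.
have [M M0 HM] := Cbpsi_common_bound Cpfs.
have [h Hh] := choice (fun n => finite_range_step n Cpfs).
have hcvg f : f \in fs ->
    (\int[mu]_x (f (h n x))%:E)%E @[n --> \oo] --> (\int[mu]_x (f x)%:E)%E.
  move=> ffs; have fp : f \in psi :: fs by rewrite inE ffs orbT.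
  have bnd n (x : S) : `|f (h n x)| <= 2 * M * psi x.
    have [_ Hn Hn'] := Hh n; have px : 1 <= psi x := psi_p_ge1 p x.
    apply: le_trans (HM _ fp _) _; rewrite [2 * M]mulrC -mulrA ler_wpM2l //.
    have [xn|xn] := leP (psi x) n%:R; last by rewrite (Hn' _ xn) psi_p0 //; lra.
    have := Hn x xn _ (mem_head _ _); rewrite ler_norml => /andP[_ hx].
    have n1 : (n.+1%:R^-1 : R) <= 1 by rewrite invf_le1 // ler1n.
    have := le_trans hx n1; lra.
  have [|||||_ _ //] := @dominated_convergence _ _ _ mu setT measurableT
    (fun n x => (f (h n x))%:E) (fun x => (f x)%:E)
    (fun x => ((2 * M)%:E * (psi x)%:E)%E).
  - move=> n; have [hn _ _] := Hh n.
    have [K [w [r [_ _ /(_ f)[mfh _]]]]] := finite_range_integral mu hn.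
    exact/measurable_EFinP.
  - by apply/measurable_EFinP; exact: (Cbpsi_measurable p1 (Cfs _ ffs)).
  - apply: aeW => x _; apply: cvg_EFin; first by near=> n.
    apply/cvgrPdist_lt => d d0; near=> n.
    have [_ Hn _] := Hh n.
    rewrite distrC; apply: le_lt_trans (Hn _ _ _ fp) _.
      by near: n; exact: nbhs_infty_ger.
    by near: n; exact: (near_infty_natSinv_lt (PosNum d0)).
  - apply: integrableZl => //; exact/Pmu/Cbpsi_psi.
  - apply: aeW => x n _; rewrite -EFinM lee_fin.
    exact: bnd.
have : \forall n \near \oo, forall f, f \in fs ->
    `|fine (\int[mu]_x (f (h n x))%:E)%E - functional_of p mu f| < e.
  apply: near_forall_seq => f ffs.
  have := hcvg f ffs; rewrite -(functional_ofE Pmu (Cfs f ffs)).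
  move=> /fine_cvg /cvgrPdist_lt /(_ e e0).
  by apply: filterS => n; rewrite distrC.
move=> [n _ /(_ n (leqnn n)) Hn].
have [hn _ _] := Hh n; have [K [w [r [w0 w1 Hw]]]] := finite_range_integral mu hn.
exists K, w, r; split => // f ffs; have := Hn f ffs.
by rewrite (Hw f).2.
Unshelve. all: by end_near. Qed.

End finite_range_approximation.

(** * Conditional expectation on the trivial sigma-algebra *)

Section risk_aversion.
Context {R : realType} {S : completeNormedModType R}.
Local Notation P := (probability (Borel S) R).
Local Notation delta z := (\d_(z : Borel S) : P).
Implicit Types (x y v : S) (m : P).

Lemma measurable_Borel_set1 x : measurable ([set x] : set (Borel S)).
Proof.
rewrite -[X in measurable X]setCK; apply: measurableC; apply: sub_sigma_algebra.
exact/closed_openC/accessible_closed_set1/hausdorff_accessible/norm_hausdorff.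
Qed.

Definition trivial_sigma : set (set S) := [set set0; setT].

Lemma sub_sigma_trivial : sub_sigma trivial_sigma.
Proof.
split.
  split.
  - by left.
  - by move=> A [->|->]; [right; rewrite setD0|left; rewrite setDv].
  - move=> A HA; have [[n An]|nA] := pselect (exists n, A n = setT).
      by right; apply/seteqP; split => // z _; exists n => //; rewrite An.
    left; apply/seteqP; split => // z [n _].
    by case: (HA n) => [->//|An]; case: nA; exists n.
by move=> A [->|->]; [exact: measurable0|exact: measurableT].
Qed.

Lemma bochner_set0 m (g : S -> S) : bochner m set0 g 0.
Proof.
split; first by move=> _ A mA; rewrite set0I; exact: measurable0.
exists (fun=> [::]); split => //; split.
  by under eq_fun do rewrite integral_set0; exact: cvg_cst.
by under eq_fun do rewrite /sfun_int big_nil; exact: cvg_cst.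
Qed.

Lemma bochner_cst m v : bochner m setT (fun=> v) v.
Proof.
split; first exact: measurable_cst.
exists (fun=> [:: (setT, v)]); split.
  by move=> n q; rewrite inE => /eqP ->; exact: measurableT.
split.
  under eq_fun do (under eq_integral do
    rewrite /sfun_eval big_seq1 /= indicT scale1r subrr normr0;
    rewrite integral0).
  exact: cvg_cst.
under eq_fun do rewrite /sfun_int big_seq1 /= setTI probability_setT scale1r.
exact: cvg_cst.
Qed.

(** Almost everywhere for [m], the identity is the simple function with value [x] at [x] and [y] at
    [y], so a constant approximating sequence suffices. *)
Lemma bochner_id_two_points (t : R) x y m : x != y -> 0 <= t <= 1 ->
  is_mixture t (delta x) (delta y) m ->
  bochner m setT id (t *: x + (1 - t) *: y).
Proof.
move=> xy t01 mm; split; first exact: measurable_id.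
have mx z : m [set z] = (t * (x == z)%:R + (1 - t) * (y == z)%:R)%:E.
  rewrite mm; last exact: measurable_Borel_set1.
  by rewrite /= !diracE !in_set1 -!EFinM.
exists (fun=> [:: ([set x], x); ([set y], y)]); split.
  by move=> n q; rewrite !inE => /orP[]/eqP ->; exact: measurable_Borel_set1.
have xyF := negbTE xy; have yxF : (y == x) = false by rewrite eq_sym.
split; last first.
  under eq_fun do rewrite /sfun_int big_cons big_seq1 /= !setTI !mx !eqxx xyF yxF /=
    !mulr1 !mulr0 addr0 add0r.
  exact: cvg_cst.
(* The approximation error: it vanishes at both atoms, hence has integral 0. *)
pose g (z : S) : R := `|z| * \1_(~` [set x; y]) z.
have gE z : `|z - sfun_eval [:: ([set x], x); ([set y], y)] z| = g z :> R.
  rewrite /g /sfun_eval big_cons big_seq1 /= !indicE !in_set1 in_setC in_setU !in_set1.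
  have [->|zx] := eqVneq z x.
    by rewrite xyF /= scale1r scale0r addr0 subrr normr0 mulr0.
  have [->|zy] := eqVneq z y; rewrite /=.
    by rewrite scale1r scale0r add0r subrr normr0 mulr0.
  by rewrite !scale0r addr0 subr0 mulr1.
have mg : measurable_fun setT (fun z : Borel S => (g z)%:E).
  apply/measurable_EFinP; apply: measurable_funM.
    apply: (@continuous_measurable_Borel _ S (fun z => `|z|)) => z.
    exact: norm_continuous.
  apply: measurable_indic; apply: measurableC; apply: measurableU;
    exact: measurable_Borel_set1.
have g0 : (\int[m]_z (g z)%:E = 0)%E.
  rewrite (is_mixture_ge0_integral t01 mm) //; last first.
    by move=> z; rewrite lee_fin mulr_ge0.
  rewrite !integral_dirac // !diracT !mul1e /g !indicE !memNset ?mulr0 ?mule0 ?adde0 //.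
    by move=> /=; apply; right.
  by move=> /=; apply; left.
under eq_fun do (under eq_integral do rewrite gE; rewrite g0).
exact: cvg_cst.
Qed.

(** Only the empty set and the whole space need checking; on the latter both integrals are the mean
    of [m]. *)
Lemma cond_exp_two_points (t : R) x y m : x != y -> 0 <= t <= 1 ->
  is_mixture t (delta x) (delta y) m ->
  cond_exp m trivial_sigma (fun=> t *: x + (1 - t) *: y).
Proof.
move=> xy t01 mm; split.
  by move=> A mA; rewrite preimage_cst; case: ifP => _; [right|left].
move=> B [->|->].
  by exists 0; split; exact: bochner_set0.
exists (t *: x + (1 - t) *: y); split; first exact: bochner_cst.
exact: bochner_id_two_points.
Qed.

End risk_aversion.

(** * Expected utility *)

Section expected_utility.
Context {R : realType} {S : completeNormedModType R}.
Variable p : R.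
Hypothesis p1 : 1 <= p.
Local Notation psi := (psi_p p : S -> R).
Local Notation P := (probability (Borel S) R).
Local Notation J := (functional_of p).
Local Notation delta z := (\d_(z : Borel S) : P).
Implicit Types mu nu lam m : P.

Variable pref : P -> P -> Prop.
Hypothesis pref_refl : forall mu, Ppsi psi mu -> pref mu mu.
Hypothesis pref_trans : forall mu nu lam, Ppsi psi mu -> Ppsi psi nu ->
  Ppsi psi lam -> pref mu nu -> pref nu lam -> pref mu lam.
Hypothesis pref_total : forall mu nu, Ppsi psi mu -> Ppsi psi nu ->
  pref mu nu \/ pref nu mu.
Hypothesis upper_closed : forall mu, Ppsi psi mu ->
  psi_weak_closed psi [set nu | Ppsi psi nu /\ pref nu mu].
Hypothesis lower_closed : forall mu, Ppsi psi mu ->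
  psi_weak_closed psi [set nu | Ppsi psi nu /\ pref mu nu].
Hypothesis indep : forall mu nu lam (a : R) m1 m2,
  Ppsi psi mu -> Ppsi psi nu -> Ppsi psi lam ->
  0 < a < 1 -> is_mixture a mu lam m1 -> is_mixture a nu lam m2 ->
  pref mu nu /\ ~ pref nu mu -> pref m1 m2 /\ ~ pref m2 m1.

Definition functionals : set ((S -> R) -> R) :=
  [set x | exists2 mu, Ppsi psi mu & x = J mu].

(** The preference is transported through some pair of inducing measures; [pref_indistinguishable]
    makes their choice immaterial. *)
Definition functional_pref (x y : (S -> R) -> R) :=
  exists mu nu, [/\ Ppsi psi mu, Ppsi psi nu, x = J mu, y = J nu & pref mu nu].

Let weak_dist mu nu f (e : R) : Ppsi psi mu -> Ppsi psi nu -> Cbpsi psi f ->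
  `|J nu f - J mu f| < e ->
  (`| \int[nu]_x (f x)%:E - \int[mu]_x (f x)%:E | < e%:E)%E.
Proof.
move=> Pmu Pnu Cf; rewrite -(functional_ofE Pmu Cf) -(functional_ofE Pnu Cf).
by rewrite -EFinB /= lte_fin.
Qed.

(* Measures that integrate C_b^psi alike are topologically indistinguishable,
   hence indifferent. *)
Lemma pref_indistinguishable mu nu : Ppsi psi mu -> Ppsi psi nu -> J mu = J nu ->
  pref mu nu.
Proof.
move=> Pmu Pnu E; apply: contrapT => nmunu.
have [|fs [e [e0 [Cfs H]]]] := @upper_closed _ Pnu mu Pmu; first by case.
apply: (H nu Pnu); last by split => //; exact: pref_refl.
by move=> f ffs; apply: weak_dist => //; [exact: Cfs|rewrite E subrr normr0].
Qed.

Lemma functional_prefE mu nu : Ppsi psi mu -> Ppsi psi nu ->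
  functional_pref (J mu) (J nu) <-> pref mu nu.
Proof.
move=> Pmu Pnu; split=> [|munu]; last by exists mu, nu.
move=> [mu' [nu' [Pmu' Pnu' Emu Enu munu']]].
apply: (pref_trans Pmu Pmu' Pnu); first exact: pref_indistinguishable.
by apply: (pref_trans Pmu' Pnu' Pnu) => //; exact: pref_indistinguishable.
Qed.

Let functionals_mix (t : R) x y : 0 <= t <= 1 -> functionals x -> functionals y ->
  functionals (mix t x y).
Proof.
move=> t01 [mu Pmu ->] [nu Pnu ->].
have [m mm] := is_mixture_exists mu nu t01.
exists m; first exact: is_mixture_Ppsi mm Pmu Pnu.
by rewrite (functional_of_mix t01 mm Pmu Pnu).
Qed.

Let strictE mu nu : Ppsi psi mu -> Ppsi psi nu ->
  strict_pref functional_pref (J mu) (J nu) <-> pref mu nu /\ ~ pref nu mu.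
Proof. by move=> Pmu Pnu; rewrite /strict_pref !functional_prefE. Qed.

Lemma functional_representation : exists U : ((S -> R) -> R) -> R,
  [/\ forall (t : R) x y, 0 <= t <= 1 -> functionals x -> functionals y ->
       U (mix t x y) = t * U x + (1 - t) * U y,
     forall mu nu, Ppsi psi mu -> Ppsi psi nu -> (pref mu nu <-> U (J nu) <= U (J mu)) &
     forall x (e : R), functionals x -> 0 < e -> exists fs (e' : R), 0 < e' /\
       forall y, functionals y -> agree fs e' x y -> `|U y - U x| < e].
Proof.
have [|||||||U [Uaff Urep Ucont]] :=
    @affine_representation R _ functionals functional_pref.
- exact: functionals_mix.
- by move=> _ [mu Pmu ->]; apply/functional_prefE => //; exact: pref_refl.
- move=> _ _ _ [mu Pmu ->] [nu Pnu ->] [lam Plam ->].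
  by rewrite !functional_prefE //; exact: pref_trans.
- move=> _ _ [mu Pmu ->] [nu Pnu ->].
  by rewrite !functional_prefE //; exact: pref_total.
- move=> _ _ _ t [mu Pmu ->] [nu Pnu ->] [lam Plam ->] t01 /(strictE Pmu Pnu) munu.
  have t01' : 0 <= t <= 1 by lra.
  have [m1 mm1] := is_mixture_exists mu lam t01'.
  have [m2 mm2] := is_mixture_exists nu lam t01'.
  rewrite -(functional_of_mix t01' mm1) // -(functional_of_mix t01' mm2) //.
  apply/strictE; [exact: is_mixture_Ppsi mm1 _ _|exact: is_mixture_Ppsi mm2 _ _|].
  exact: indep mm1 mm2 munu.
(* By totality, strictly beating [lam] means lying outside its closed lower contour set. *)
- move=> _ _ [mu Pmu ->] [lam Plam ->] /(strictE Pmu Plam)[_ nlm].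
  have [|fs [e [e0 [Cfs H]]]] := @lower_closed _ Plam mu Pmu; first by case.
  exists fs, e; split=> // _ [nu Pnu ->] ag; apply/strictE => //.
  have nln : ~ pref lam nu.
    move=> ln; apply: (H nu Pnu) => // f ffs.
    by apply: weak_dist => //; [exact: Cfs|exact: ag].
  by split=> //; case: (pref_total Pnu Plam).
- move=> _ _ [mu Pmu ->] [lam Plam ->] /(strictE Plam Pmu)[_ nlm].
  have [|fs [e [e0 [Cfs H]]]] := @upper_closed _ Plam mu Pmu; first by case.
  exists fs, e; split=> // _ [nu Pnu ->] ag; apply/strictE => //.
  have nln : ~ pref nu lam.
    move=> ln; apply: (H nu Pnu) => // f ffs.
    by apply: weak_dist => //; [exact: Cfs|exact: ag].
  by split=> //; case: (pref_total Pnu Plam).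
exists U; split => // mu nu Pmu Pnu.
by rewrite -functional_prefE //; apply: Urep; [exists mu|exists nu].
Qed.

(** * From an affine continuous utility to an integral *)

Section integral_representation.
Variable U : ((S -> R) -> R) -> R.
Hypothesis Uaff : forall (t : R) x y, 0 <= t <= 1 -> functionals x -> functionals y ->
  U (mix t x y) = t * U x + (1 - t) * U y.
Hypothesis Ucont : forall x (e : R), functionals x -> 0 < e -> exists fs (e' : R),
  0 < e' /\ forall y, functionals y -> agree fs e' x y -> `|U y - U x| < e.

Definition utility (z : S) : R := U (J (delta z)).

Let functionals_dirac z : functionals (J (delta z)).
Proof. by exists (delta z) => //; exact: Ppsi_dirac. Qed.

(** Test functions in C_b^psi are continuous, so the Dirac mass at w tends to the one at z as w
    tends to z. Outside C_b^psi the functionals vanish. *)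
Lemma continuous_utility : continuous utility.
Proof.
move=> z; apply/cvgrPdist_lt => e e0.
have [fs [e' [e'0 H]]] := Ucont (functionals_dirac z) e0.
have : \forall w \near z, forall f, f \in fs -> `|J (delta w) f - J (delta z) f| < e'.
  apply: near_forall_seq => f _.
  have [Cf|Cf] := pselect (Cbpsi psi f); last first.
    by apply: nearW => w; rewrite !functional_of_out // subrr normr0.
  have cf : f w @[w --> z] --> f z by exact: (Cbpsi_continuous p1 Cf).
  have /cvgrPdist_lt /(_ e' e'0) := cf.
  by apply: filterS => w; rewrite distrC !functional_of_dirac.
by apply: filterS => w Hw; rewrite distrC; apply: H => //; exact: Hw.
Qed.

(* Moving mass t ~ 1 / psi z from 0 to z stays in a fixed psi-weak
   neighbourhood of the Dirac mass at 0, on which U oscillates by at most 1. *)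
Lemma utility_bounded : exists M : R, forall z, `|utility z| <= M * psi z.
Proof.
have [fs [e [e0 H]]] := Ucont (functionals_dirac 0) ltr01.
have [|M M0 HM] := @Cbpsi_common_bound _ _ p [seq f <- fs | `[< Cbpsi psi f >]].
  by move=> f; rewrite mem_filter => /andP[/asboolP].
exists (`|utility 0| + (e + 2 * M + 1) / e) => z.
have pz : 1 <= psi z := psi_p_ge1 p z.
(* With t = e / D, the term e gives t <= 1 and the others give t |f z - f 0| < e. Since D grows at
   most like psi z, so does the bound D / e. *)
set D := e + 2 * M * psi z + 1.
have Mpz : 0 <= M * psi z by rewrite mulr_ge0 //; lra.
have D0 : 0 < D by rewrite /D; lra.
pose t := e / D.
have tD : t * D = e by rewrite /t divfK // gt_eqF.
have t0 : 0 < t by rewrite divr_gt0.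
have t1 : t <= 1 by rewrite /t ler_pdivrMr // mul1r /D; lra.
have t01 : 0 <= t <= 1 by lra.
have ag : agree fs e (J (delta 0)) (mix t (J (delta z)) (J (delta 0))).
  move=> f ffs; rewrite /mix.
  have [Cf|Cf] := pselect (Cbpsi psi f); last first.
    by rewrite !functional_of_out // !mulr0 addr0 subrr normr0.
  rewrite !functional_of_dirac //.
  have -> : t * f z + (1 - t) * f 0 - f 0 = t * (f z - f 0) by ring.
  have f' : f \in [seq f <- fs | `[< Cbpsi psi f >]].
    by rewrite mem_filter ffs andbT; exact/asboolP.
  have fz := HM f f' z; have f0 := HM f f' 0.
  rewrite psi_p0 // mulr1 in f0.
  have d : `|f z - f 0| <= 2 * M * psi z.
    apply: le_trans (ler_normB _ _) _; have : M <= M * psi z by rewrite ler_peMr.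
    lra.
  rewrite normrM (gtr0_norm t0); apply: (@le_lt_trans _ _ (t * (2 * M * psi z))).
    by rewrite ler_pM2l.
  by rewrite -[ltRHS]tD ltr_pM2l // /D; lra.
have := H _ (functionals_mix t01 (functionals_dirac z) (functionals_dirac 0)) ag.
rewrite Uaff // -/(utility z) -/(utility 0).
have -> : t * utility z + (1 - t) * utility 0 - utility 0 =
  t * (utility z - utility 0) by ring.
rewrite normrM (gtr0_norm t0) => h.
have h' : `|utility z - utility 0| <= D / e.
  rewrite ler_pdivlMr // -tD mulrA -[leRHS]mul1r ler_pM2r //.
  by rewrite mulrC ltW.
have tri : `|utility z| <= `|utility 0| + `|utility z - utility 0|.
  by rewrite -[X in `|X| <= _](subrKC (utility 0)); exact: ler_normD.
have u0 := normr_ge0 (utility 0).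
have k1 : `|utility 0| <= `|utility 0| * psi z by rewrite ler_peMr.
have k2 : D / e <= (e + 2 * M + 1) / e * psi z.
  rewrite mulrAC ler_pM2r ?invr_gt0 // /D; nra.
by rewrite mulrDl; lra.
Qed.

Lemma Cbpsi_utility : Cbpsi psi utility.
Proof. by have [M HM] := utility_bounded; exact: CbpsiP continuous_utility HM. Qed.

(** On a finitely supported measure both sides agree because [U] is affine. Such a measure can be
    chosen so close to [mu] that each side moves by less than half of the supposed gap; for the left
    side, [utility] itself joins the test functions. *)
Lemma utility_integral mu : Ppsi psi mu -> J mu utility = U (J mu).
Proof.
move=> Pmu; apply/eqP; rewrite -subr_eq0 -normr_eq0 eq_le normr_ge0 andbT.
rewrite leNgt; apply/negP => d0; set d := `|_| in d0.
have d2 : 0 < d / 2 by rewrite divr_gt0.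
have Fmu : functionals (J mu) by exists mu.
have [fs [e [e0 H]]] := Ucont Fmu d2.
have em : 0 < Num.min e (d / 2) by rewrite lt_min e0.
have [|K [w [r [w0 w1 Hw]]]] := finite_support_dense
    (fs := utility :: [seq f <- fs | `[< Cbpsi psi f >]]) p1 Pmu em.
  move=> f; rewrite inE mem_filter => /predU1P[->|/andP[/asboolP //]].
  exact: Cbpsi_utility.
have [Fy Uy] := finite_mixture functionals_mix Uaff w0 w1
  (fun k => functionals_dirac (r k)).
have ag : agree fs e (J mu) (fun f => \sum_k w k * J (delta (r k)) f).
  move=> f ffs; have [Cf|Cf] := pselect (Cbpsi psi f); last first.
    rewrite functional_of_out // big1 ?subrr ?normr0 // => k _.
    by rewrite functional_of_out // mulr0.
  have := Hw f; rewrite inE mem_filter ffs (asboolT Cf) orbT lt_min.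
  move=> /(_ erefl)/andP[+ _].
  suff -> : \sum_k w k * J (delta (r k)) f = \sum_k w k * f (r k) by [].
  by apply: eq_bigr => k _; rewrite functional_of_dirac.
have := H _ Fy ag; rewrite Uy.
have := Hw utility (mem_head _ _); rewrite lt_min => /andP[_].
set s := \sum_k _ => h1 h2.
have : d <= `|J mu utility - s| + `|s - U (J mu)|.
  rewrite /d (_ : J mu utility - U (J mu) = (J mu utility - s) + (s - U (J mu))).
    exact: ler_normD.
  ring.
by rewrite distrC in h1; lra.
Qed.

End integral_representation.
End expected_utility.

Theorem mainTheorem7 (R : realType) (S : completeNormedModType R)
  (le : S -> S -> Prop) (p : R)
  (pref : probability (Borel S) R -> probability (Borel S) R -> Prop) :
  banach_lattice_order le ->
  separable (T := S) ->
  1 <= p ->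
  (* total preorder on P^{psi_p}(S) *)
  (forall mu, Ppsi (psi_p p) mu -> pref mu mu) ->
  (forall mu nu lam, Ppsi (psi_p p) mu -> Ppsi (psi_p p) nu ->
     Ppsi (psi_p p) lam -> pref mu nu -> pref nu lam -> pref mu lam) ->
  (forall mu nu, Ppsi (psi_p p) mu -> Ppsi (psi_p p) nu ->
     pref mu nu \/ pref nu mu) ->
  (* continuity: upper and lower contour sets are psi_p-weakly closed *)
  (forall mu, Ppsi (psi_p p) mu ->
     psi_weak_closed (psi_p p) [set nu | Ppsi (psi_p p) nu /\ pref nu mu] /\
     psi_weak_closed (psi_p p) [set nu | Ppsi (psi_p p) nu /\ pref mu nu]) ->
  (* risk aversion: mu_G >= mu *)
  (forall mu (G : set (set S)) (E : S -> S) (muG : probability (Borel S) R),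
     Ppsi (psi_p p) mu -> sub_sigma G -> cond_exp mu G E ->
     (forall A, measurable (A : set (Borel S)) -> muG A = mu (E @^-1` A)) ->
     pref muG mu) ->
  (* independence axiom *)
  (forall mu nu lam (a : R) m1 m2,
     Ppsi (psi_p p) mu -> Ppsi (psi_p p) nu -> Ppsi (psi_p p) lam ->
     0 < a < 1 -> is_mixture a mu lam m1 -> is_mixture a nu lam m2 ->
     pref mu nu /\ ~ pref nu mu -> pref m1 m2 /\ ~ pref m2 m1) ->
  exists u : S -> R,
    concave_fun u /\ Cbpsi (psi_p p) u /\
    (forall mu nu, Ppsi (psi_p p) mu -> Ppsi (psi_p p) nu ->
       ((pref mu nu /\ ~ pref nu mu) <->
        (\int[nu]_x (u x)%:E < \int[mu]_x (u x)%:E)%E)).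
Proof.
move=> _ _ p1 prefl ptrans ptotal closed averse indep.
have up mu (Pmu : Ppsi (psi_p p) mu) := (closed mu Pmu).1.
have dn mu (Pmu : Ppsi (psi_p p) mu) := (closed mu Pmu).2.
have [U [Uaff Urep Ucont]] :=
  functional_representation prefl ptrans ptotal up dn indep.
have Cu := Cbpsi_utility p1 Uaff Ucont.
have Uint := utility_integral p1 Uaff Ucont.
exists (utility p U); split; [|split => //].
  (* The two-atom computation requires distinct points. *)
  move=> x y t t01; have [->|xy] := eqVneq x y.
    by rewrite -mulrDl -scalerDl subrKC scale1r mul1r.
  pose v := t *: x + (1 - t) *: y.
  pose dx := (\d_(x : Borel S) : probability (Borel S) R).
  pose dy := (\d_(y : Borel S) : probability (Borel S) R).
  pose dv := (\d_(v : Borel S) : probability (Borel S) R).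
  have [m mm] := is_mixture_exists dx dy t01.
  have [Px Py Pv] := And3 (Ppsi_dirac p1 x) (Ppsi_dirac p1 y) (Ppsi_dirac p1 v).
  have Pm : Ppsi (psi_p p) m by exact: is_mixture_Ppsi mm Px Py.
  (* The conditional expectation of [m] is the constant [v], whose law is the Dirac mass at [v];
     risk aversion prefers it to [m]. *)
  have : pref dv m.
    apply: averse Pm sub_sigma_trivial (cond_exp_two_points xy t01 mm) _.
    move=> A mA; rewrite preimage_cst /dv /= diracE.
    by case: ifP => _; [rewrite probability_setT|rewrite measure0].
  move=> /(Urep _ _ Pv Pm); rewrite (functional_of_mix t01 mm Px Py) Uaff //.
    by exists dx.
  by exists dy.
move=> mu nu Pmu Pnu; rewrite -(functional_ofE Pmu Cu) -(functional_ofE Pnu Cu).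
rewrite lte_fin !Uint //.
split=> [[_ nnm]|h]; first by rewrite ltNge; apply/negP => /(Urep _ _ Pnu Pmu).
have nnm : ~ pref nu mu by move/(Urep _ _ Pnu Pmu); rewrite leNgt h.
by split=> //; case: (ptotal _ _ Pmu Pnu).
Qed.
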